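(* Let $(G,d)$ be a strongly connected graph with absorption, with graph Laplacian $L$, and let $L^d$ be the absorption inverse of $L$ with respect to $d$. For any real $z>0$, $$(L+zD)^{-1}=\frac1z U+(I+zL^dD)^{-1}L^d .$$ (In particular the inverses appearing here exist.)
   Context: $G$ is a strongly connected, weighted, directed graph on $V=\{1,\dots,n\}$ with weighted adjacency matrix $A=(a_{ij})\in\mathbb{R}^{n\times n}$, $a_{ij}\ge 0$, where $a_{ij}$ is the weight of the edge from $j$ to $i$ (with $a_{ij}>0$ exactly when that edge is present). The outdegrees are $w_i=\sum_{j=1}^n a_{ji}$, $W=\mathrm{diag}\{w\}$, and the graph Laplacian is $L=W-A$, so $\mathbf{1}^TL=0$, where $\mathbf{1}$ is the column vector of ones. The vector $d=(d_1,\dots,d_n)^T$ has all $d_i>0$ (absorption rates), and $D=\mathrm{diag}\{d\}$. The kernel of $L$ is one-dimensional; $u$ denotes its unique spanning vector with positive entries and $\sum_i u_i=1$. Put $\bar d=d^Tu$ and $U=u\mathbf{1}^T/\bar d$. Let $N_{1,0}=\{x\in\mathbb{R}^n: Dx\in\mathrm{range}\,L\}$ and $R_{1,0}=\{Dx: x\in\ker L\}$. The absorption inverse $L^d$ of $L$ with respect to $d$ is the (unique) matrix $X\in\mathbb{R}^{n\times n}$ with $XLy=y$ for all $y\in N_{1,0}$ and $Xy=0$ for all $y\in R_{1,0}$. *)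

(* Defs.v *)
From HB Require Import structures.
From mathcomp Require Import all_boot all_order all_algebra.
From mathcomp Require Import reals.
Set Implicit Arguments.
Unset Strict Implicit.
Unset Printing Implicit Defensive.
Import Order.TTheory GRing.Theory Num.Theory.
Local Open Scope ring_scope.

(* A graph on 'I_n is given by its weighted adjacency matrix: A i j is the
   weight of the edge from j to i, and the edge is present iff 0 < A i j. *)
Definition edge (R : realType) (n : nat) (A : 'M[R]_n) : rel 'I_n :=
  fun j i => 0 < A i j.

Definition nonneg_weights (R : realType) (n : nat) (A : 'M[R]_n) : Prop :=
  forall i j, 0 <= A i j.

Definition strongly_connected (R : realType) (n : nat) (A : 'M[R]_n) : Prop :=
  forall i j, connect (edge A) i j.

Definition outdegree (R : realType) (n : nat) (A : 'M[R]_n) : 'cV[R]_n :=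
  \col_i \sum_j A j i.

Definition cdiag (R : realType) (n : nat) (v : 'cV[R]_n) : 'M[R]_n :=
  diag_mx v^T.

Definition laplacian (R : realType) (n : nat) (A : 'M[R]_n) : 'M[R]_n :=
  cdiag (outdegree A) - A.

(* At most one such vector exists when L is the Laplacian of a strongly
   connected graph, since ker L is then one-dimensional. The normalization
   forces 0 < n. *)
Definition positive_kernel_vector (R : realType) (n : nat)
    (L : 'M[R]_n) (u : 'cV[R]_n) : Prop :=
  [/\ L *m u = 0, forall i, 0 < u i 0 & \sum_i u i 0 = 1].

Definition dbar (R : realType) (n : nat) (d u : 'cV[R]_n) : R :=
  (d^T *m u) 0 0.

Definition Umx (R : realType) (n : nat) (d u : 'cV[R]_n) : 'M[R]_n :=
  (dbar d u)^-1 *: (u *m const_mx 1).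

(* Ranges and kernels are those of the action on column vectors, hence not
   the row-space notions of mxalgebra. *)
Definition N10 (R : realType) (n : nat) (L : 'M[R]_n) (d x : 'cV[R]_n) : Prop :=
  exists y : 'cV[R]_n, cdiag d *m x = L *m y.

Definition R10 (R : realType) (n : nat) (L : 'M[R]_n) (d y : 'cV[R]_n) : Prop :=
  exists2 x : 'cV[R]_n, L *m x = 0 & y = cdiag d *m x.

Definition is_absorption_inverse (R : realType) (n : nat)
    (L : 'M[R]_n) (d : 'cV[R]_n) (X : 'M[R]_n) : Prop :=
  (forall y : 'cV[R]_n, N10 L d y -> X *m L *m y = y) /\
  (forall y : 'cV[R]_n, R10 L d y -> X *m y = 0).

(* Main.v *)
Require Import Defs.
From mathcomp Require Import all_boot all_order all_algebra.
From mathcomp Require Import reals.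
Import Order.TTheory GRing.Theory Num.Theory.
Local Open Scope ring_scope.
Set Implicit Arguments.
Unset Strict Implicit.

(** The maximum principle for the row action of [L] shows that [L + z D] is
    invertible and, by strong connectivity, that the left kernel of [L] consists
    of the constant rows, so that [range L] is the hyperplane [1^T y = 0].  Hence
    [L^d] is characterized by [L^d L = I - U D] and [L^d D U = 0].  These give
    [(L^d + U / z) (L + z D U D) = I] and [I + z L^d D = (L^d + U / z) (L + z D)],
    so [I + z L^d D] is invertible; it fixes [U], and multiplying the right-hand
    side of the formula by [L + z D] gives [I]. *)

Lemma row_laplacianE (R : realType) (n : nat) (A : 'M[R]_n) (x : 'rV[R]_n) j :
  (x *m laplacian A) 0 j = \sum_i (x 0 j - x 0 i) * A i j.
Proof.
rewrite mulmxBr mul_mx_diag !mxE mulr_sumr -sumrB.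
by apply: eq_bigr => i _; rewrite mulrBl.
Qed.

Lemma ones_laplacian (R : realType) (n m : nat) (A : 'M[R]_n) :
  const_mx 1 *m laplacian A = 0 :> 'M_(m, n).
Proof.
apply/row_matrixP => i; rewrite row_mul row_const row0.
apply/rowP => j; rewrite row_laplacianE big1 ?mxE // => k _.
by rewrite !mxE subrr mul0r.
Qed.

Lemma row_max_exists (R : realType) (n : nat) (x : 'rV[R]_n) (i0 : 'I_n) :
  exists m, forall i, x 0 i <= x 0 m.
Proof.
by case: (arg_maxP (x 0) (erefl true : predT i0)) => m _ max_m; exists m => i;
  apply: max_m.
Qed.

(** At a vertex where [x] is maximal, [row_laplacianE] writes 0 as a sum of nonnegative terms, so
    [x] takes the same value at every out-neighbour; paths carry the maximum to all vertices. *)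
Lemma row_laplacian_ker_const (R : realType) (n : nat) (A : 'M[R]_n)
    (x : 'rV[R]_n) :
  nonneg_weights A -> strongly_connected A -> x *m laplacian A = 0 ->
  forall i j, x 0 i = x 0 j.
Proof.
move=> A_ge0 A_conn xL0 i0 j0.
have [m max_m] := row_max_exists x i0.
suff eq_m i : x 0 i = x 0 m by rewrite !eq_m.
have step k l : edge A k l -> x 0 k = x 0 m -> x 0 l = x 0 m.
  rewrite /edge => A_gt0 xk.
  move/rowP/(_ k): xL0; rewrite row_laplacianE mxE => /eqP.
  rewrite psumr_eq0 => [/allP/(_ l)|j _]; last first.
    by rewrite mulr_ge0 // subr_ge0 xk.
  rewrite mem_index_enum mulf_eq0 (gt_eqF A_gt0) orbF subr_eq0 => /(_ isT) /eqP <-.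
  exact: xk.
have steps p : forall k, x 0 k = x 0 m -> path (edge A) k p ->
    x 0 (last k p) = x 0 m.
  elim: p => //= l p IHp k xk /andP[kl l_p].
  by apply: IHp l_p; apply: step kl xk.
by have /connectP[p m_p ->] := A_conn m i; apply: steps.
Qed.

(** If [x] is in the left kernel and maximal at [m], then [x 0 m * d m 0] is minus a sum of
    nonnegative terms, so [x] is nonpositive; the same holds for [- x]. *)
Lemma laplacian_addD_unit (R : realType) (n : nat) (A : 'M[R]_n)
    (d : 'cV[R]_n) :
  nonneg_weights A -> (forall i, 0 < d i 0) ->
  laplacian A + cdiag d \in unitmx.
Proof.
move=> A_ge0 d_gt0.
have row_le0 (x : 'rV[R]_n) : x *m (laplacian A + cdiag d) = 0 ->
    forall i, x 0 i <= 0.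
  move=> xM0 i0.
  have [m max_m] := row_max_exists x i0; apply: le_trans (max_m i0) _.
  move/rowP/(_ m): xM0; rewrite mulmxDr mul_mx_diag mxE row_laplacianE !mxE.
  move=> /eqP; rewrite addrC addr_eq0 => /eqP xd.
  rewrite -(pmulr_lle0 _ (d_gt0 m)) xd oppr_le0 sumr_ge0 // => i _.
  by rewrite mulr_ge0 // subr_ge0 max_m.
rewrite unitmxE unitfE; apply/det0P => -[x /eqP x_neq0 xM0]; case: x_neq0.
apply/rowP => i; apply/eqP; rewrite mxE eq_le row_le0 //=.
have := row_le0 (- x); rewrite mulNmx xM0 oppr0 => /(_ erefl i).
by rewrite mxE oppr_le0.
Qed.

Lemma laplacian_range (R : realType) (n : nat) (A : 'M[R]_n) (v : 'cV[R]_n) :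
  nonneg_weights A -> strongly_connected A -> \sum_i v i 0 = 0 ->
  exists y : 'cV[R]_n, v = laplacian A *m y.
Proof.
move=> A_ge0 A_conn sum_v.
suff /submxP[y vE] : (v^T <= (laplacian A)^T)%MS.
  by exists y^T; rewrite -[LHS]trmxK vE trmx_mul trmxK.
rewrite submxE; apply/eqP/matrixP => i k.
(* A column of the cokernel of the transpose is a left kernel row of the Laplacian, hence constant,
   and pairs with [v] to a multiple of its entry sum. *)
pose c := row k (cokermx (laplacian A)^T)^T.
have cL0 : c *m laplacian A = 0.
  by rewrite -row_mul -[X in _ *m X]trmxK -trmx_mul mulmx_coker trmx0 row0.
have c_const := row_laplacian_ker_const A_ge0 A_conn cL0.
rewrite !mxE; transitivity ((\sum_j v j 0) * c 0 k); last first.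
  by rewrite sum_v mul0r.
rewrite mulr_suml; apply: eq_bigr => j _.
by rewrite (c_const _ j) !mxE ord1.
Qed.

Section AbsorptionInverse.

Variables (R : realType) (n : nat) (A : 'M[R]_n) (d u : 'cV[R]_n).
Variable Ld : 'M[R]_n.
Hypotheses (A_ge0 : nonneg_weights A) (A_conn : strongly_connected A).
Hypothesis d_gt0 : forall i, 0 < d i 0.
Hypothesis u_ker : positive_kernel_vector (laplacian A) u.
Hypothesis Ld_inv : is_absorption_inverse (laplacian A) d Ld.

Let L := laplacian A.
Let D := cdiag d.
Let U := Umx d u.

Lemma dbar_gt0 : 0 < dbar d u.
Proof.
have [_ u_gt0 u_sum] := u_ker; rewrite /dbar mxE.
(* An empty vertex set would make the entries of [u] sum to 0. *)
have [j0|no_ord] := pickP 'I_n; last first.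
  move/eqP: u_sum; rewrite big1 => [|i]; last by have := no_ord i.
  by rewrite eq_sym oner_eq0.
rewrite (bigD1 j0) //= mxE ltr_wpDr ?mulr_gt0 // sumr_ge0 // => i _.
by rewrite mxE mulr_ge0 ?ltW.
Qed.

Lemma ones_cdiag : const_mx 1 *m D = d^T.
Proof. by apply/rowP => i; rewrite mul_mx_diag !mxE mul1r. Qed.

Lemma UmxDE : U *m D = (dbar d u)^-1 *: (u *m d^T).
Proof. by rewrite -scalemxAl -mulmxA ones_cdiag. Qed.

(** Dividing by [dbar d u] makes [U *m D] the projection onto the span of [u] along the hyperplane
    [d^T *m x = 0], which is [N10]. *)
Lemma UmxDu : U *m D *m u = u.
Proof.
rewrite UmxDE -scalemxAl -mulmxA [d^T *m u]mx11_scalar mul_mx_scalar scalerA.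
by rewrite mulVf ?scale1r // gt_eqF // dbar_gt0.
Qed.

Lemma UmxDU : U *m D *m U = U.
Proof. by rewrite {2 3}/U -scalemxAr mulmxA UmxDu. Qed.

Lemma UmxL : U *m L = 0.
Proof. by rewrite -scalemxAl -mulmxA ones_laplacian mulmx0 scaler0. Qed.

Lemma absorption_inverseDU : Ld *m D *m U = 0.
Proof.
have [_ LdR] := Ld_inv; have [Lu0 _ _] := u_ker.
rewrite -scalemxAr mulmxA -[Ld *m D *m u]mulmxA LdR ?mul0mx ?scaler0 //.
by exists u.
Qed.

(** Since [L *m U = 0], [L] is unchanged by composing with the projection [1%:M - U *m D], whose
    columns lie in [N10], where [Ld *m L] is the identity. *)
Lemma absorption_inverseL : Ld *m L = 1%:M - U *m D.
Proof.
have [LdN _] := Ld_inv; have [Lu0 _ _] := u_ker.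
have LU0 : L *m U = 0 by rewrite -scalemxAr mulmxA Lu0 mul0mx scaler0.
have DUD : const_mx 1 *m D *m (1%:M - U *m D) = 0 :> 'rV_n.
  rewrite ones_cdiag UmxDE mulmxBr mulmx1 -scalemxAr mulmxA.
  rewrite [d^T *m u]mx11_scalar mul_scalar_mx scalerA mulVf ?scale1r ?subrr //.
  by rewrite gt_eqF // dbar_gt0.
apply: (canRL (addrK _)).
suff: Ld *m L *m (1%:M - U *m D) = 1%:M - U *m D.
  rewrite mulmxBr mulmx1 -[Ld *m L *m _]mulmxA [L *m _]mulmxA LU0 mul0mx.
  by rewrite mulmx0 subr0 => ->; rewrite subrK.
apply/trmx_inj/row_matrixP => j; rewrite -!tr_col; congr (_^T).
rewrite colE -mulmxA -colE; apply: LdN.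
apply: laplacian_range => //.
transitivity (((const_mx 1 : 'rV_n) *m (D *m col j (1%:M - U *m D))) 0 0).
  by rewrite [RHS]mxE; apply: eq_bigr => i _; rewrite [const_mx _ _ _]mxE mul1r.
by rewrite colE !mulmxA DUD mul0mx mxE.
Qed.

End AbsorptionInverse.

Theorem theorem5 (R : realType) (n : nat) (A : 'M[R]_n) (d u : 'cV[R]_n)
    (Ld : 'M[R]_n) (z : R)
    (A_ge0 : nonneg_weights A)
    (A_conn : strongly_connected A)
    (d_gt0 : forall i, 0 < d i 0)
    (u_ker : positive_kernel_vector (laplacian A) u)
    (Ld_inv : is_absorption_inverse (laplacian A) d Ld)
    (z_gt0 : 0 < z) :
  [/\ laplacian A + z *: cdiag d \in unitmx,
      1%:M + z *: (Ld *m cdiag d) \in unitmx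
    & invmx (laplacian A + z *: cdiag d) =
      z^-1 *: Umx d u + invmx (1%:M + z *: (Ld *m cdiag d)) *m Ld].
Proof.
have z_neq0 : z != 0 by rewrite gt_eqF.
have UL := @UmxL R n A d u.
have LdL := absorption_inverseL A_ge0 A_conn d_gt0 u_ker Ld_inv.
have LdDU := absorption_inverseDU u_ker Ld_inv.
have UDU := UmxDU d_gt0 u_ker.
have M_unit : laplacian A + z *: cdiag d \in unitmx.
  (* The rates [z *: d] are again positive. *)
  have -> : z *: cdiag d = cdiag (z *: d) by rewrite /cdiag !linearZ.
  by apply: laplacian_addD_unit => // i; rewrite mxE mulr_gt0.
set L := laplacian A in UL LdL M_unit *; set D := cdiag d in LdL LdDU UDU M_unit *.
set U := Umx d u in UL LdL LdDU UDU *.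
clearbody L D U.
set M := L + z *: D in M_unit *; set B := 1%:M + z *: (Ld *m D).
have UM : U *m M = z *: (U *m D) by rewrite mulmxDr UL add0r scalemxAr.
have LdM : Ld *m M = B - U *m D by rewrite mulmxDr LdL -scalemxAr addrAC.
have BE : B = (Ld + z^-1 *: U) *m M.
  by rewrite mulmxDl LdM -scalemxAl UM scalerA mulVf // scale1r subrK.
(* [Ld *m L] contributes [1%:M - U *m D], the product of the two [U] terms contributes [U *m D], and
   the cross terms vanish. *)
have inv_factor : (Ld + z^-1 *: U) *m (L + z *: (D *m U *m D)) = 1%:M.
  rewrite mulmxDl !mulmxDr LdL -!scalemxAl UL scaler0 add0r -!scalemxAr.
  by rewrite !mulmxA LdDU UDU mul0mx scaler0 addr0 scalerA mulVf // scale1r subrK.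
have B_unit : B \in unitmx.
  by rewrite BE unitmx_mul M_unit andbT; case: (mulmx1_unit inv_factor).
have BU : invmx B *m U = U.
  by apply: (canLR (mulKmx B_unit)); rewrite mulmxDl mul1mx -scalemxAl LdDU scaler0 addr0.
(* Times [M], the right-hand side is [U *m D + invmx B *m (B - U *m D)], and [invmx B] fixes
   [U *m D]. *)
split=> //; rewrite -[RHS](mulmxK M_unit) mulmxDl -scalemxAl UM scalerA.
by rewrite mulVf // scale1r -mulmxA LdM mulmxBr mulVmx // mulmxA BU addrC subrK mul1mx.
Qed.
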